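(* There exists a computable function $f:\mathbb{N}\to\mathbb{N}$ with the following property. Let $\Sigma$ be a finite alphabet and let $X\subseteq \Sigma^{\mathbb{Z}^2}$ be a $\mathbb{Z}^2$-subshift such that for every finite set $P\subseteq \mathbb{Z}^2\setminus\{(0,0)\}$ there is a configuration $x\in X$ that avoids every $p\in P$ (i.e. for each $p\in P$ there is $z\in\mathbb{Z}^2$ with $x_z\neq x_{z+p}$). Then $X$ contains an aperiodic configuration $x$ such that for every $p\in\mathbb{Z}^2\setminus\{(0,0)\}$ there exists $z\in\mathbb{Z}^2$ with $\|z\|_\infty\le f(\|p\|_\infty)$ and $x_z\neq x_{z+p}$.
   Context: A $\mathbb{Z}^2$-subshift is a closed (for the product topology) subset $X\subseteq\Sigma^{\mathbb{Z}^2}$ invariant under all shifts $\sigma_v$, $(\sigma_v(x))_z=x_{z+v}$. A configuration $x$ is periodic with period $v\in\mathbb{Z}^2\setminus\{(0,0)\}$ if $x_z=x_{z+v}$ for all $z$; it is aperiodic if it has no period. For $p\in\mathbb{Z}^2$, a pair $(z,z+p)$ with $x_z\neq x_{z+p}$ is called an avoidance of $p$, and $x$ avoids $p$ if such a pair exists. Norms are the uniform norm $\|\cdot\|_\infty$. *)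

(* Defs.v *)
From HB Require Import structures.
From mathcomp Require Import all_boot all_order all_algebra.
From mathcomp Require Import all_classical.
From mathcomp Require Import topology.

Set Implicit Arguments.
Unset Strict Implicit.
Unset Printing Implicit Defensive.

Import GRing.Theory.
Local Open Scope classical_set_scope.
Local Open Scope ring_scope.

(** Syntax of Kleene's partial (mu-)recursive functions, indexed by arity. *)
Inductive recfun : nat -> Type :=
| RZero n : recfun n
| RSucc : recfun 1
| RProj n (i : 'I_n) : recfun n
| RComp k n (g : recfun k) (h : 'I_k -> recfun n) : recfun n
| RPrec n (g : recfun n) (h : recfun n.+2) : recfun n.+1
| RMu n (g : recfun n.+1) : recfun n.

(** [rec_eval e v y]: the partial function denoted by [e] is defined at [v] and
    takes the value [y] there.
    - [RPrec g h] is the function F with F(0, u) = g(u) and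
      F(i+1, u) = h(i, F(i, u), u); [s] lists the values F(0, u), ..., F(x, u).
    - [RMu g] maps v to the least y with g(y, v) = 0, provided g(i, v) is defined
      (and nonzero) for every i < y. *)
Fixpoint rec_eval n (e : recfun n) : n.-tuple nat -> nat -> Prop :=
  match e in recfun n return n.-tuple nat -> nat -> Prop with
  | RZero _ => fun _ y => y = 0%N
  | RSucc => fun v y => y = (thead v).+1
  | RProj _ i => fun v y => y = tnth v i
  | RComp k _ g h => fun v y =>
      exists w : k.-tuple nat,
        (forall i, rec_eval (h i) v (tnth w i)) /\ rec_eval g w y
  | RPrec n g h => fun v y =>
      let x := thead v in
      let u : n.-tuple nat := [tuple of behead v] in
      exists s : nat -> nat,
        [/\ rec_eval g u (s 0%N),
            forall i, (i < x)%N ->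
              rec_eval h [tuple of i :: s i :: u] (s i.+1)
          & y = s x]
  | RMu _ g => fun v y =>
      rec_eval g [tuple of y :: v] 0%N /\
      forall i, (i < y)%N ->
        exists m : nat, rec_eval g [tuple of i :: v] m.+1
  end.

Definition computable (f : nat -> nat) : Prop :=
  exists e : recfun 1, forall n y : nat, rec_eval e [tuple n] y <-> y = f n.

Notation Z2 := (int * int)%type.

Definition norm_oo (z : Z2) : nat := maxn `|z.1|%N `|z.2|%N.

(** Sigma^(Z^2) with the product topology, Sigma being discrete. *)
Definition config (Sigma : finType) : topologicalType :=
  {ptws Z2 -> discrete_topology Sigma}.

Definition shift (Sigma : finType) (v : Z2) (x : config Sigma) : config Sigma :=
  fun z => x (z + v).

Definition subshift (Sigma : finType) (X : set (config Sigma)) : Prop :=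
  closed X /\ forall v x, X x -> X (shift v x).

Definition is_period (Sigma : finType) (x : config Sigma) (v : Z2) : Prop :=
  v <> 0 /\ forall z : Z2, x z = x (z + v).

Definition aperiodic (Sigma : finType) (x : config Sigma) : Prop :=
  ~ exists v : Z2, is_period x v.

Definition avoids_at (Sigma : finType) (x : config Sigma) (p z : Z2) : Prop :=
  x z <> x (z + p).

Definition avoids (Sigma : finType) (x : config Sigma) (p : Z2) : Prop :=
  exists z : Z2, avoids_at x p z.

(* Main.v *)
(** List the nonzero vectors as q_0, q_1, ... and call a point z k-good for x when
    each q_i with i < k is avoided within a distance r_i of z, where r_i depends
    on i only.  The key fact ([local_period]) is that a configuration without
    k-good points in a large ball has, on a smaller concentric ball, the period
    N_i q_i for some i < k.

    It is proved by induction on k.  Suppose that there is a k-good point z but no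
    (k+1)-good one, and write q = q_k.  Then x is locally q-periodic around z, so
    z + l q is k-good for every l.  Were N_k q avoided at y, no k-good point could
    be near y, so by induction x has a period N_i q_i around y.  If q_i is
    collinear with q, then N_k q is a multiple of N_i q_i, a contradiction;
    otherwise the avoidance at y can be moved by N_i q_i or its opposite,
    whichever gets closer to the line z + Z q.  Repeating this brings it near one
    of the k-good points z + l q, which would then be (k+1)-good.

    Hence a configuration avoiding every N_i q_i with i < k has a k-good point.
    Shifting it to the origin and letting k tend to infinity, compactness gives
    the required configuration. *)

Require Import Defs.
From HB Require Import structures.
From mathcomp Require Import all_boot all_order all_algebra.
From mathcomp Require Import all_classical.
From mathcomp Require Import topology.
From mathcomp Require Import zify ring.

Set Implicit Arguments.
Unset Strict Implicit.
Unset Printing Implicit Defensive.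

Import Order.TTheory GRing.Theory Num.Theory.

Local Open Scope classical_set_scope.
Local Open Scope ring_scope.

(** * Distances and determinants in the lattice *)

Definition dist (u v : Z2) : nat := norm_oo (u - v).

Definition det (u v : Z2) : int := u.1 * v.2 - u.2 * v.1.

Arguments norm_oo z%_ring_scope.
Arguments dist u%_ring_scope v%_ring_scope.
Arguments det u%_ring_scope v%_ring_scope.

Lemma mulz_pair (u : Z2) (c : int) : u *~ c = (u.1 * c, u.2 * c).
Proof.
by rewrite [u *~ c]surjective_pairing (raddfMz fst) (raddfMz snd) !mulrzz.
Qed.

Lemma norm_oo_mulz (u : Z2) (c : int) : norm_oo (u *~ c) = (`|c| * norm_oo u)%N.
Proof. by rewrite mulz_pair /norm_oo /= !abszM -maxnMl mulnC. Qed.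

Lemma norm_oo_gt0 (u : Z2) : u <> 0 -> (0 < norm_oo u)%N.
Proof.
case: u => a b; rewrite /norm_oo /= => u0.
case: (eqVneq a 0) => a0; last lia.
by case: (eqVneq b 0) => b0; [case: u0; rewrite a0 b0|lia].
Qed.

Lemma dist_sym (u v : Z2) : dist u v = dist v u.
Proof. case: u v => [a b] [c d]; rewrite /dist /norm_oo /=; lia. Qed.

Lemma dist_triangle (u v w : Z2) : (dist u w <= dist u v + dist v w)%N.
Proof. case: u v w => [a b] [c d] [e f]; rewrite /dist /norm_oo /=; lia. Qed.

Lemma dist_addr (u v : Z2) : dist (u + v) u = norm_oo v.
Proof. by rewrite /dist addrC addKr. Qed.

Lemma distxx (u : Z2) : dist u u = 0%N.
Proof. by rewrite /dist subrr. Qed.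

Lemma dist_addl (u v w : Z2) : (dist (u + v) w <= norm_oo v + dist u w)%N.
Proof. by rewrite -(dist_addr u v) dist_triangle. Qed.

Lemma det_bound (u v : Z2) : (`|det u v| <= 2 * norm_oo u * norm_oo v)%N.
Proof.
case: u v => [a b] [c d]; rewrite /det /norm_oo /=.
have h1 : (`|(a * d)%R| <= maxn `|a| `|b| * maxn `|c| `|d|)%N.
  by rewrite abszM leq_mul ?leq_maxl ?leq_maxr.
have h2 : (`|(b * c)%R| <= maxn `|a| `|b| * maxn `|c| `|d|)%N.
  by rewrite abszM leq_mul ?leq_maxl ?leq_maxr.
lia.
Qed.

Lemma det_mulzl (u v : Z2) (c : int) : det (u *~ c) v = c * det u v.
Proof. rewrite mulz_pair /det /=; ring. Qed.

Lemma detBl (u v w : Z2) : det (u - v) w = det u w - det v w.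
Proof. case: u v w => [a b] [c d] [e f]; rewrite /det /=; ring. Qed.

(** Divide [a] by [c] with remainder [r]: the first coordinate becomes [r], and [(b + e * l) * c = r
    * e - (a * e - b * c)] controls the second. *)
Lemma near_line_coord (a b c e : int) : c != 0 -> (`|e| <= `|c|)%N ->
  exists l : int, [/\ (`|l| <= `|a| + 1)%N, (`|(a + c * l)%R| <= `|c|)%N &
    (`|(b + e * l)%R| <= `|c| + `|(a * e - b * c)%R|)%N].
Proof.
move=> c0 ec; exists (- (a %/ c)%Z).
have Ea := divz_eq a c.
have r0 := modz_ge0 a c0.
have r1 := ltz_mod a c0.
move: (a %/ c)%Z (a %% c)%Z Ea r0 r1 => l r Ea r0 r1.
have c1 : (0 < `|c|)%N by lia.
have E1 : a + c * - l = r by rewrite Ea; ring.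
have E2 : (b + e * - l) * c = r * e - (a * e - b * c) by rewrite Ea; ring.
rewrite E1; split; last 2 first.
- lia.
- rewrite -(leq_pmul2r c1) -abszM E2.
  have h : (`|(r * e)%R| <= `|c| * `|c|)%N by rewrite abszM leq_mul //; lia.
  rewrite mulnDl.
  have : (`|(a * e - b * c)%R| <= `|(a * e - b * c)%R| * `|c|)%N by rewrite leq_pmulr.
  lia.
- have : (`|(l * c)%R| <= `|a| + `|c|)%N by lia.
  rewrite abszM abszN; nia.
Qed.

(** The division is applied to the coordinate in which [q] attains its norm. Thus a small
    determinant means that [y] is close to the line. *)
Lemma near_line (z y q : Z2) : q <> 0 -> exists l : int,
  (`|l| <= dist z y + 1)%N /\
  (dist (z + q *~ l) y <= norm_oo q + `|det (z - y) q|)%N.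
Proof.
move=> q0; have qgt0 := norm_oo_gt0 q0; move: qgt0 {q0}.
rewrite /dist; under eq_exists => l do rewrite addrAC.
move: (z - y) => {z y} [a b]; case: q => c e.
rewrite /det /norm_oo => /= q0.
have [ec|ce] := leqP `|e| `|c|.
  have [|l [l1 l2 l3]] := @near_line_coord a b c e _ ec; first lia.
  by exists l; rewrite mulz_pair /=; lia.
have [||l [l1 l2 l3]] := @near_line_coord b a e c; [lia|lia|].
by exists l; rewrite mulz_pair /=; lia.
Qed.

(** * Local periods and avoidances *)

Definition periodic_on {T : Type} (x : Z2 -> T) (p : Z2) (s : nat) (w : Z2) :=
  forall y, (dist y w <= s)%N -> x y = x (y + p).

Definition avoided_near {T : Type} (x : Z2 -> T) (p : Z2) (s : nat) (z : Z2) :=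
  exists2 y, (dist y z <= s)%N & x y <> x (y + p).

Lemma not_avoided_near {T : Type} (x : Z2 -> T) p s z :
  ~ avoided_near x p s z -> periodic_on x p s z.
Proof.
by move=> h y hy; apply: contrapT => hx; apply: h; exists y.
Qed.

Lemma constant_along {T : Type} (x : Z2 -> T) (p u : Z2) (c : nat) :
  (forall t : nat, (t < c)%N -> x (u + p *~ t) = x (u + p *~ t + p)) ->
  x u = x (u + p *~ c).
Proof.
elim: c => [|c IH] h; first by rewrite mulr0z addr0.
rewrite IH => [|t tc]; last by apply: h; exact: ltnW.
by rewrite h // -addn1 PoszD mulrzDr mulr1z addrA.
Qed.

Lemma avoided_factor {T : Type} (x : Z2 -> T) (p y : Z2) (c : nat) :
  x y <> x (y + p *~ c) -> avoided_near x p (c * norm_oo p) y.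
Proof.
move=> h; apply: contrapT => h'; apply: h; apply: constant_along => t tc.
apply: (not_avoided_near h').
by rewrite dist_addr norm_oo_mulz leq_mul2r (ltnW tc) orbT.
Qed.

Lemma periodic_on_mulz {T : Type} (x : Z2 -> T) (p y : Z2) (c : int) s :
  periodic_on x p s y -> (norm_oo (p *~ c) <= s)%N -> x y = x (y + p *~ c).
Proof.
move=> hp; rewrite norm_oo_mulz => hc.
case: c hc => n hc.
  apply: constant_along => t tn; apply: hp; rewrite dist_addr norm_oo_mulz.
  by apply: leq_trans hc; rewrite leq_mul2r; lia.
(* For a negative multiple, telescope forward from the other end. *)
rewrite {1}[y](_ : _ = y + p *~ Negz n + p *~ n.+1); last first.
  by rewrite NegzE mulrNz subrK.
symmetry; apply: constant_along => t tn; apply: hp.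
rewrite -addrA dist_addr -mulrzDr norm_oo_mulz.
by apply: leq_trans hc; rewrite leq_mul2r; lia.
Qed.

(** * Multipliers and radii *)

(* The multiplier N_k: it is divisible by a N_i for all i < k and 0 < a <= i + 1,
   which makes N_k q_k a multiple of N_i q_i for collinear q_i and q_k. *)
Fixpoint mult (k : nat) : nat :=
  if k is k'.+1 then (mult k' * k'.+1`!)%N else 1%N.

(* [radius k] is the ratio of the radii of the two balls in [local_period];
   r_k is [radius k.+1]. *)
Fixpoint radius (k : nat) : nat :=
  if k is k'.+1 then (8 * radius k' * mult k' * k'.+1 ^ 3)%N else 1%N.

Lemma mult_gt0 k : (0 < mult k)%N.
Proof. by elim: k => //= k IH; rewrite muln_gt0 IH fact_gt0. Qed.

Lemma radius_gt0 k : (0 < radius k)%N.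
Proof. by elim: k => //= k IH; rewrite !muln_gt0 IH mult_gt0. Qed.

Lemma dvdn_mult i k : (i < k)%N -> (mult i * i.+1`! %| mult k)%N.
Proof.
elim: k => // k IH; rewrite ltnS leq_eqVlt => /orP[/eqP -> //|ik].
by rewrite /= dvdn_mulr ?IH.
Qed.

Lemma leq_mult i k : (i < k)%N -> (mult i <= mult k)%N.
Proof.
move=> ik; apply: dvdn_leq (mult_gt0 _) _.
by apply: dvdn_trans (dvdn_mult ik); rewrite dvdn_mulr.
Qed.

Lemma leq_radiusS k : (radius k + 2 * k.+1 <= radius k.+1)%N.
Proof.
rewrite /= -!mulnA; have := radius_gt0 k; have := mult_gt0 k.
have : (k.+1 <= k.+1 ^ 3)%N by rewrite -{1}[k.+1]expn1 leq_pexp2l.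
nia.
Qed.

Lemma leq_radius : {homo radius : i k / (i <= k)%N}.
Proof.
apply: homo_leq => // [i j k|k]; first exact: leq_trans.
by have := leq_radiusS k; lia.
Qed.

(** A nonzero coordinate [e] of [p] divides the factorial of [k], so [n = m * e * t]. By
    collinearity [q *~ e] is a multiple of [p], hence [q *~ n] is one of [p *~ m]. *)
Lemma collinear_multiple (p q : Z2) (m n k : nat) :
  p <> 0 -> (norm_oo p <= k)%N -> det p q = 0 -> (m * k`! %| n)%N ->
  exists c : int, q *~ n = p *~ m *~ c.
Proof.
case: p q => [a b] [c d] p0; rewrite /norm_oo /det /= => pk /eqP.
rewrite subr_eq0 => /eqP pq mn.
have key (e : int) : e != 0 -> (`|e| <= k)%N -> exists t : int, n%:Z = m%:Z * e * t.
  move=> e0 ek; have /dvdnP[t nt] : (m * `|e| %| n)%N.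
    apply: dvdn_trans mn; apply: dvdn_mul => //.
    by apply: dvdn_fact; lia.
  by exists (t%:Z * sgz e); rewrite nt !PoszM abszE mulrA [in RHS]mulrAC; lia.
case: (eqVneq a 0) => [a0|a0].
  have b0 : b != 0.
    by apply/eqP => b0; apply: p0; rewrite a0 b0.
  have [|t nt] := key b b0; first by lia.
  have c0 : c = 0.
    move/eqP: pq; rewrite a0 mul0r eq_sym mulf_eq0 (negPf b0) => /eqP //.
  exists (t * d); rewrite !mulz_pair /= a0 c0; congr pair; rewrite ?nt; ring.
have [|t nt] := key a a0; first by lia.
exists (t * c); rewrite !mulz_pair /=; congr pair; first by rewrite nt; ring.
by rewrite nt (_ : d * _ = a * d * m * t); [rewrite pq; ring|ring].
Qed.


(** * Good points and the local period *)

Definition good {T : Type} (x : Z2 -> T) (q : nat -> Z2) (k : nat) (z : Z2) :=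
  forall i, (i < k)%N -> avoided_near x (q i) (radius i.+1) z.

(** Each avoidance of [q i] moves along with [z]: the points read all lie where [v] is a period,
    because [radius k.+1] exceeds [radius k] by at least [2 * k.+1], room enough for [q i] and
    [v]. *)
Lemma good_translate {T : Type} (x : Z2 -> T) (q : nat -> Z2) k z (v : Z2) :
  (forall i, (norm_oo (q i) <= i.+1)%N) -> (norm_oo v <= k.+1)%N ->
  periodic_on x v (radius k.+1) z -> good x q k z ->
  good x q k (z + v) /\ good x q k (z - v).
Proof.
move=> hq hv per gz; split=> i ik; have [y yz xy] := gz i ik.
all: have ri := leq_radius ik; have rk := leq_radiusS k.
all: have qi := hq i.
- exists (y + v); first by move: yz; rewrite /dist opprD addrACA subrr addr0.
  rewrite addrAC -(per y) -?(per (y + q i)) //; last by lia.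
  by have := dist_addl y (q i) z; lia.
- exists (y - v); first by move: yz; rewrite /dist opprD addrACA subrr addr0.
  have vN : norm_oo (- v) = norm_oo v by rewrite -[- v]mulrN1z norm_oo_mulz mul1n.
  rewrite addrAC (per (y - v)) ?(per (y + q i - v)) ?subrK //.
    have := dist_addl (y + q i) (- v) z; have := dist_addl y (q i) z; lia.
  have := dist_addl y (- v) z; lia.
Qed.

(** Taken at [A = radius k], [N = mult k], [m = k.+1], this is what the factor 8 and the cube in
    [radius] are for. The first two bounds keep good points in the large ball; the last two keep
    avoidances within [radius k.+1] of them. *)
Lemma radius_bounds (A N m s : nat) : (0 < A)%N -> (0 < N)%N -> (0 < m)%N ->
  (0 < s)%N -> let C := (s + 2 * m * (A + 1) * s * (N * m))%N in
  [/\ (C + A * (2 * N * m) <= 8 * A * N * m ^ 3 * s)%N,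
  (A * s + (A * s + C + 1) * m <= 8 * A * N * m ^ 3 * s)%N,
  (A * (2 * N * m) + N * m <= 8 * A * N * m ^ 3)%N &
  (m + 2 * N * m ^ 2 + N * m <= 8 * A * N * m ^ 3)%N].
Proof.
rewrite !expnS expn0 !muln1.
case: A N m s => // A [//|N] [//|m] [//|s] _ _ _ _ /=.
by split; lia.
Qed.

Lemma local_period {T : Type} (x : Z2 -> T) (q : nat -> Z2) :
  (forall i, q i <> 0) -> (forall i, (norm_oo (q i) <= i.+1)%N) ->
  forall k s w, (0 < s)%N ->
  (forall z, (dist z w <= radius k * s)%N -> ~ good x q k z) ->
  exists2 i, (i < k)%N & periodic_on x (q i *~ mult i) s w.
Proof.
move=> q0 hq; elim=> [|k IH] s w s0 ngood.
  by case: (ngood w) => //; rewrite distxx.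
have [ng|] := pselect (forall z, (dist z w <= radius k * s)%N -> ~ good x q k z).
  by have [i ik per] := IH s w s0 ng; exists i => //; exact: ltnW.
move=> /existsNP[z0 /not_implyP[z0w /contrapT gz0]].
exists k => //; apply: not_avoided_near => -[y0 y0w xy0].
set N := mult k in xy0; set A := radius k in z0w; set m := k.+1.
set p := q k in xy0.
have N0 : (0 < N)%N := mult_gt0 k.
have A0 : (0 < A)%N := radius_gt0 k.
have pm : (norm_oo p <= m)%N := hq k.
(* [C] bounds the distance from [w] during the walk below, which starts within [s] and makes at most
   [2 * m * (A + 1) * s] steps of length at most [N * m]. *)
pose C := (s + 2 * m * (A + 1) * s * (N * m))%N.
have [Rad1 Rad2 r1 r2] : [/\ (C + A * (2 * N * m) <= radius k.+1 * s)%N,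
    (A * s + (A * s + C + 1) * m <= radius k.+1 * s)%N,
    (A * (2 * N * m) + N * m <= radius k.+1)%N &
    (m + 2 * N * m ^ 2 + N * m <= radius k.+1)%N] := radius_bounds A0 N0 (ltn0Sn k) s0.
(* An avoidance of [p *~ N] yields one of [p] at most [N * m] away, which would make a nearby k-good
   point (k+1)-good. *)
have no_near (z y : Z2) : good x q k z -> (dist z w <= radius k.+1 * s)%N ->
    x y <> x (y + p *~ N) -> (dist y z + N * m <= radius k.+1)%N -> False.
  move=> gz zw /avoided_factor[y' y'y xy'] yz; apply: (ngood z zw) => i.
  rewrite ltnS leq_eqVlt => /orP[/eqP ->|]; last exact: gz.
  exists y' => //; apply: leq_trans (dist_triangle _ y _) _.
  apply: leq_trans yz; rewrite addnC leq_add2l.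
  by apply: leq_trans y'y _; rewrite leq_mul2l pm orbT.
have per z : good x q k z -> (dist z w <= radius k.+1 * s)%N ->
    periodic_on x p (radius k.+1) z.
  move=> gz zw; apply: not_avoided_near => av; apply: (ngood z zw) => i.
  by rewrite ltnS leq_eqVlt => /orP[/eqP ->|]; last exact: gz.
(* Goodness passes from point to point by the local period [p], as long as the line stays in the
   large ball. *)
have line (l : int) : (dist z0 w + `|l| * m <= radius k.+1 * s)%N ->
    good x q k (z0 + p *~ l) /\ (dist (z0 + p *~ l) w <= radius k.+1 * s)%N.
  have dl (j : int) : (dist (z0 + p *~ j) w <= dist z0 w + `|j| * m)%N.
    rewrite addnC; apply: leq_trans (dist_addl _ _ _) _.
    by rewrite leq_add2r norm_oo_mulz leq_mul2l pm orbT.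
  move=> hl; split; last exact: leq_trans (dl l) hl.
  have gnat (n : nat) : (dist z0 w + n * m <= radius k.+1 * s)%N ->
      good x q k (z0 + p *~ n) /\ good x q k (z0 - p *~ n).
    elim: n => [|n IHn] hn; first by rewrite mulr0z oppr0 addr0.
    have [|g1 g2] := IHn; first by move: hn; rewrite mulSn; lia.
    rewrite -addn1 PoszD mulrzDr mulr1z opprD !addrA; split.
      have [|//] := good_translate hq pm _ g1; apply: per => //.
      by apply: leq_trans (dl n) _; move: hn; rewrite mulSn /=; lia.
    have [|//] := good_translate hq pm _ g2; apply: per => //.
    rewrite -mulrNz; apply: leq_trans (dl _) _.
    by move: hn; rewrite mulSn /=; lia.
  case: l hl => n hl; first by case: (gnat n hl).
  by rewrite NegzE mulrNz; case: (gnat n.+1 hl).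
(* The determinant measures how far [y] is from the line; [n] bounds the number of steps until it is
   at most [2 * N * m ^ 2]. *)
suff walk n (y : Z2) : (`|det (z0 - y) p| <= 2 * N * m ^ 2 + n)%N ->
    (dist y w + n * (N * m) <= C)%N -> x y <> x (y + p *~ N) -> False.
  have d0 : (dist z0 y0 <= (A + 1) * s)%N.
    apply: leq_trans (dist_triangle _ w _) _.
    by rewrite mulnDl mul1n (dist_sym w) leq_add.
  apply: (walk (2 * m * (A + 1) * s)%N y0) => //; last first.
    by rewrite /C leq_add2r.
  apply: leq_trans (det_bound _ _) _; rewrite -/(dist z0 y0).
  apply: leq_trans (leq_addl _ _).
  by rewrite -!mulnA leq_mul2l /= mulnC leq_mul.
elim: n y => [|n IHn] y; last first.
  have [dle _|dgt dy] := leqP `|det (z0 - y) p| (2 * N * m ^ 2).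
    move=> yw; apply: IHn; first by lia.
    by move: yw; rewrite mulSn; lia.
  move=> yw xy.
  have [ng|] := pselect (forall z, (dist z y <= A * (2 * N * m))%N -> ~ good x q k z);
    last first.
    move=> /existsNP[z /not_implyP[zy /contrapT gz]].
    apply: (no_near z y gz _ xy); last by rewrite dist_sym; lia.
    by apply: leq_trans (dist_triangle _ y _) _; lia.
  (* The radius [2 * N * m] has room for [p *~ N] and one step of the walk. *)
  have [|i ik peri] := IH _ y _ ng; first by rewrite !muln_gt0 N0.
  have Ni := leq_mult ik.
  have qi : (norm_oo (q i *~ mult i) <= N * m)%N.
    rewrite norm_oo_mulz leq_mul //; apply: leq_trans (hq i) _.
    by rewrite /m; lia.
  have pN : (norm_oo (p *~ N) <= N * m)%N.
    by rewrite norm_oo_mulz leq_mul //.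
  have [det0|det0] := eqVneq (det (q i) p) 0.
    have [c Ec] := collinear_multiple (q0 i) (hq i) det0 (dvdn_mult ik).
    apply: xy; rewrite Ec; apply: periodic_on_mulz peri _.
    by rewrite -Ec; apply: leq_trans pN _; lia.
  (* Being nonzero and smaller in absolute value than the current determinant, it brings that one
     strictly closer to zero when subtracted with the right sign. *)
  have dq : (0 < `|det (q i *~ mult i) p| <= 2 * N * m ^ 2)%N.
    rewrite det_mulzl abszM muln_gt0 mult_gt0 absz_gt0 det0 /=.
    rewrite [(2 * N)%N]mulnC -mulnA leq_mul //.
    apply: leq_trans (det_bound _ _) _.
    rewrite expnS expn1 -mulnA leq_mul2l leq_mul //.
    by apply: leq_trans (hq i) _; rewrite /m; lia.
  have move_ok (v : Z2) : v = q i *~ mult i \/ v = - (q i *~ mult i) ->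
      x (y + v) = x y /\ x (y + v + p *~ N) = x (y + p *~ N).
    move=> hv.
    have hv' : norm_oo v = norm_oo (q i *~ mult i).
      by case: hv => -> //; rewrite -mulrNz !norm_oo_mulz abszN.
    have d1 := dist_addr y (p *~ N); have d2 := dist_addr y v.
    have d3 := dist_addl (y + v) (p *~ N) y.
    case: hv => ve.
      by rewrite addrAC ve -!peri // ?distxx // d1; lia.
    have uE (z : Z2) : z = z + v + q i *~ mult i by rewrite ve subrK.
    split; first by rewrite {2}[y]uE -peri // d2; lia.
    rewrite (peri (y + v + p *~ N)); last by lia.
    by rewrite addrAC -uE.
  have step (v : Z2) : v = q i *~ mult i \/ v = - (q i *~ mult i) ->
      (`|det (z0 - y) p - det v p| < `|det (z0 - y) p|)%N -> False.
    move=> hv dv; have [x1 x2] := move_ok v hv.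
    apply: (IHn (y + v)); last by rewrite x1 x2.
      by rewrite opprD addrA detBl -ltnS -addnS; exact: leq_trans dv dy.
    have := dist_addl y v w; move: yw; rewrite mulSn.
    suff : (norm_oo v <= N * m)%N by lia.
    by case: hv => ->; rewrite // -mulrNz norm_oo_mulz abszN -norm_oo_mulz.
  have e1 := step _ (or_introl erefl); have e2 := step _ (or_intror erefl).
  move: e1 e2; rewrite -mulrNz [det (_ *~ - _) _]det_mulzl mulNr -det_mulzl.
  lia.
(* End of the walk: some point of the line is close to [y], and it is k-good. *)
move=> dy yw xy.
have [l [lb ld]] := near_line z0 y (q0 k : p <> 0).
have zy := dist_triangle z0 w y.
have [|gl lw] := line l.
  apply: leq_trans Rad2; rewrite leq_add // leq_mul2r.
  by apply/orP; right; rewrite (dist_sym w) in zy; lia.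
apply: (no_near _ y gl lw xy); rewrite dist_sym; lia.
Qed.

(** * Enumeration of the nonzero vectors *)

(* The pair (a, b) has the code 2^|a| 3^|b| 5^[a < 0] 7^[b < 0]. *)
Definition code_sign (s : nat) : int := if s is 0 then 1 else -1.

Definition vector_of_code (k : nat) : Z2 :=
  (code_sign (logn 5 k) * (logn 2 k)%:Z, code_sign (logn 7 k) * (logn 3 k)%:Z).

Definition vector_enum (k : nat) : Z2 :=
  if vector_of_code k == 0 then (1, 0) else vector_of_code k.

Lemma vector_enum_neq0 k : vector_enum k <> 0.
Proof. by rewrite /vector_enum; case: eqP. Qed.

(** Prime exponents in [k] are at most [k]; the successor allows for the default [(1, 0)] at
    [k = 0]. *)
Lemma norm_vector_enum k : (norm_oo (vector_enum k) <= k.+1)%N.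
Proof.
rewrite /vector_enum; case: eqP => // _.
have logn_le p : (logn p k <= k)%N.
  by case: k => [|k]; [rewrite logn0|apply: ltnW; apply: ltn_logl].
rewrite /norm_oo /vector_of_code /= !abszM.
have s1 n : `|code_sign n|%N = 1%N by case: n.
by rewrite !s1 !mul1n geq_max !leqW //=; exact: logn_le.
Qed.

(** The bound turns radii depending on the index into a function of the norm: [6 = 2 * 3] accounts
    for the absolute values, [35 = 5 * 7] for the signs. *)
Lemma vector_enum_surj (p : Z2) : p <> 0 ->
  exists2 k, (k <= 35 * 6 ^ norm_oo p)%N & vector_enum k = p.
Proof.
case: p => a b p0; pose s (c : int) : nat := (c < 0)%R.
have sg (c : int) : code_sign (s c) * `|c|%N = c.
  by rewrite /s; case: (ltrP c 0) => /= c0; lia.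
pose k := (2 ^ `|a| * (3 ^ `|b| * (5 ^ s a * 7 ^ s b)))%N.
have pos q n : (0 < q)%N -> (0 < q ^ n)%N by move=> ?; rewrite expn_gt0; lia.
have kE : vector_of_code k = (a, b).
  have lk l : logn l k =
      (`|a| * logn l 2 + (`|b| * logn l 3 + (s a * logn l 5 + s b * logn l 7)))%N.
    by rewrite /k !lognM ?muln_gt0 ?pos // !lognX.
  rewrite /vector_of_code !lk.
  rewrite [logn 2 2]/= [logn 2 3]/= [logn 2 5]/= [logn 2 7]/=.
  rewrite [logn 3 2]/= [logn 3 3]/= [logn 3 5]/= [logn 3 7]/=.
  rewrite [logn 5 2]/= [logn 5 3]/= [logn 5 5]/= [logn 5 7]/=.
  rewrite [logn 7 2]/= [logn 7 3]/= [logn 7 5]/= [logn 7 7]/=.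
  rewrite !muln0 !muln1 !addn0 !add0n.
  by congr pair; rewrite sg.
exists k; last by rewrite /vector_enum kE; case: eqP.
have le q (c : int) : (0 < q)%N -> (q ^ s c <= q)%N.
  by move=> q0'; rewrite /s; case: (c < 0); rewrite // expn0.
have l2 : (2 ^ `|a| <= 2 ^ norm_oo (a, b))%N by rewrite leq_exp2l // leq_maxl.
have l3 : (3 ^ `|b| <= 3 ^ norm_oo (a, b))%N by rewrite leq_exp2l // leq_maxr.
rewrite /k mulnA mulnC -[6%N]/(2 * 3)%N expnMn leq_mul ?leq_mul //.
by rewrite -[35%N]/(5 * 7)%N leq_mul ?le.
Qed.

(** * Computability of the bound *)

Definition computable_tuple n (F : n.-tuple nat -> nat) : Prop :=
  exists e : recfun n, forall v y, rec_eval e v y <-> y = F v.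

Lemma computable_tuple_ext n (F G : n.-tuple nat -> nat) :
  F =1 G -> computable_tuple F -> computable_tuple G.
Proof. by move=> FG [e he]; exists e => v y; rewrite he FG. Qed.

Lemma computable_proj n (i : 'I_n) : computable_tuple (fun v => tnth v i).
Proof. by exists (RProj i). Qed.

Lemma computable_comp k n (G : k.-tuple nat -> nat)
    (H : 'I_k -> n.-tuple nat -> nat) :
  computable_tuple G -> (forall i, computable_tuple (H i)) ->
  computable_tuple (fun v => G [tuple H i v | i < k]).
Proof.
move=> [g hg] /fin_all_exists[h hh]; exists (RComp g h) => v y /=; split.
  move=> [w [hw /hg ->]]; congr G; apply: eq_from_tnth => i.
  by rewrite tnth_mktuple; apply/hh.
move=> ->; exists [tuple H i v | i < k]; split; last exact/hg.
by move=> i; apply/hh; rewrite tnth_mktuple.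
Qed.

Lemma computable_comp1 n (g : nat -> nat) (F : n.-tuple nat -> nat) :
  computable_tuple (fun v : 1.-tuple nat => g (tnth v ord0)) ->
  computable_tuple F -> computable_tuple (fun v => g (F v)).
Proof.
move=> hg hF; apply: computable_tuple_ext (computable_comp hg (fun=> hF)).
by move=> v; rewrite tnth_mktuple.
Qed.

Lemma computable_comp2 n (op : nat -> nat -> nat) (F G : n.-tuple nat -> nat) :
  computable_tuple (fun v : 2.-tuple nat => op (tnth v ord0) (tnth v ord_max)) ->
  computable_tuple F -> computable_tuple G ->
  computable_tuple (fun v => op (F v) (G v)).
Proof.
move=> hop hF hG.
have hH (i : 'I_2) : computable_tuple (if i == ord0 then F else G) by case: ifP.
apply: computable_tuple_ext (computable_comp hop hH).
by move=> v; rewrite !tnth_mktuple.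
Qed.

Lemma computable_succ n (F : n.-tuple nat -> nat) :
  computable_tuple F -> computable_tuple (fun v => (F v).+1).
Proof. by apply: (computable_comp1 (g := succn)); exists RSucc. Qed.

Lemma computable_cst n (c : nat) : computable_tuple (fun _ : n.-tuple nat => c).
Proof.
by elim: c => [|c IH]; [exists (RZero n)|apply: computable_succ].
Qed.

(** By induction, the recursion forces the sequence [s] to agree with [F] up to [thead v];
    conversely [F] itself gives such a sequence. *)
Lemma computable_prec n (F : nat -> n.-tuple nat -> nat)
    (G : n.-tuple nat -> nat) (H : n.+2.-tuple nat -> nat) :
  computable_tuple G -> computable_tuple H -> (forall u, F 0%N u = G u) ->
  (forall i u, F i.+1 u = H [tuple of i :: F i u :: u]) ->
  computable_tuple (fun v : n.+1.-tuple nat => F (thead v) [tuple of behead v]).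
Proof.
move=> [g hg] [h hh] F0 FS; exists (RPrec g h) => v y /=; split.
  move=> [s [/hg s0 sS ->]].
  suff sF i : (i <= thead v)%N -> s i = F i [tuple of behead v] by exact: sF.
  elim: i => [|i IH] iv; first by rewrite s0 F0.
  by move/hh: (sS i iv) => ->; rewrite FS IH // ltnW.
move=> ->; exists (fun i => F i [tuple of behead v]); split => //.
  exact/hg.
by move=> i _; apply/hh; rewrite FS.
Qed.

Lemma computable_primrec (f : nat -> nat) (h : nat -> nat -> nat) :
  computable_tuple (fun v : 2.-tuple nat => h (tnth v ord0) (tnth v ord_max)) ->
  (forall i, f i.+1 = h i (f i)) ->
  computable_tuple (fun v : 1.-tuple nat => f (tnth v ord0)).
Proof.
move=> hh fS.
exact: (@computable_prec 0 (fun i _ => f i) (fun=> f 0%N) _ (computable_cst _ _) hh).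
Qed.

Lemma computable_add n (F G : n.-tuple nat -> nat) :
  computable_tuple F -> computable_tuple G ->
  computable_tuple (fun v => (F v + G v)%N).
Proof.
apply: computable_comp2.
have hS := computable_succ (computable_proj (lift ord0 (@ord0 1))).
apply: computable_tuple_ext (@computable_prec 1 (fun i u => i + tnth u ord0)%N _ _
  (computable_proj ord0) hS _ _) => //.
by move=> v; rewrite !(tnth_nth 0%N) /= nth_behead /thead (tnth_nth 0%N).
Qed.

Lemma computable_mul n (F G : n.-tuple nat -> nat) :
  computable_tuple F -> computable_tuple G ->
  computable_tuple (fun v => (F v * G v)%N).
Proof.
apply: computable_comp2.
have hA := computable_add (computable_proj (@ord_max 2))
  (computable_proj (lift ord0 (@ord0 1))).
have hS i (u : 1.-tuple nat) : (i.+1 * tnth u ord0)%N =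
    (tnth [tuple of i :: (i * tnth u ord0)%N :: u] (@ord_max 2) +
     tnth [tuple of i :: (i * tnth u ord0)%N :: u] (lift ord0 (@ord0 1)))%N.
  by rewrite mulSn !(tnth_nth 0%N).
apply: computable_tuple_ext (@computable_prec 1 (fun i u => i * tnth u ord0)%N _ _
  (computable_cst 1 0%N) hA _ hS) => //.
by move=> v; rewrite !(tnth_nth 0%N) /= nth_behead /thead (tnth_nth 0%N).
Qed.

Lemma computable_fact :
  computable_tuple (fun v : 1.-tuple nat => (tnth v ord0)`!).
Proof.
apply: (computable_primrec (h := fun i y => (i.+1 * y)%N)) => //.
by apply: computable_mul; [apply: computable_succ|]; exact: computable_proj.
Qed.

Lemma computable_mult :
  computable_tuple (fun v : 1.-tuple nat => mult (tnth v ord0)).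
Proof.
apply: (computable_primrec (h := fun i y => (y * i.+1`!)%N)) => //.
apply: computable_mul; first exact: computable_proj.
by apply: (computable_comp1 computable_fact); apply/computable_succ/computable_proj.
Qed.

Lemma computable_radius :
  computable_tuple (fun v : 1.-tuple nat => radius (tnth v ord0)).
Proof.
apply: (computable_primrec
  (h := fun i y => (8 * y * mult i * (i.+1 * (i.+1 * i.+1)))%N)) => //.
have hi := computable_proj (@ord0 1); have hS := computable_succ hi.
apply: computable_mul; last by do 2?apply: computable_mul.
apply: computable_mul; last exact: (computable_comp1 computable_mult).
by apply: computable_mul; [exact: computable_cst|exact: computable_proj].
Qed.

Lemma computable_avoidance_bound :
  computable (fun n => radius (35 * 6 ^ n).+1).
Proof.
suff [e he] : computable_tuple
    (fun v : 1.-tuple nat => radius (35 * 6 ^ tnth v ord0).+1).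
  by exists e => n y; rewrite he.
apply: (computable_comp1 computable_radius); apply: computable_succ.
apply: computable_mul; first exact: computable_cst.
apply: (computable_primrec (h := fun _ y => (6 * y)%N)).
  by apply: computable_mul; [exact: computable_cst|exact: computable_proj].
by move=> i; rewrite expnS.
Qed.

(** * Existence of good points and passage to the limit *)

(** Finitely many avoidances fit in one ball; without good points, [local_period] would make one of
    the [q i *~ mult i] a period there. *)
Lemma good_spot {T : Type} (x : Z2 -> T) (q : nat -> Z2) k :
  (forall i, q i <> 0) -> (forall i, (norm_oo (q i) <= i.+1)%N) ->
  (forall i, (i < k)%N -> exists z, x z <> x (z + q i *~ mult i)) ->
  exists z, good x q k z.
Proof.
move=> q0 hq av.
have [s hs] : exists s, forall i, (i < k)%N ->
    avoided_near x (q i *~ mult i) s 0.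
  elim: k av => [|k IH] av; first by exists 0%N.
  have [|s hs] := IH; first by move=> i ik; apply: av; exact: ltnW.
  have [z xz] := av k (ltnSn k).
  exists (maxn s (dist z 0)) => i; rewrite ltnS leq_eqVlt => /orP[/eqP ->|].
    by exists z; rewrite ?leq_maxr.
  by move=> /hs[y ys xy]; exists y; rewrite // leq_max ys.
apply: contrapT => ng.
(* The successor makes the radius positive. *)
have [|i ik per] := @local_period _ x q q0 hq k s.+1 0 (ltn0Sn s).
  by move=> z _ gz; apply: ng; exists z.
by have [y ys xy] := hs i ik; apply: xy; apply: per; exact: leqW.
Qed.

Lemma compact_config (Sigma : finType) : compact [set: config Sigma].
Proof.
have cS : compact [set: discrete_topology Sigma].
  by apply: finite_compact; exact: (@finite_finset Sigma).
have := @tychonoff Z2 (fun=> discrete_topology Sigma) (fun=> setT) (fun=> cS).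
by congr compact; apply/seteqP; split.
Qed.

Lemma nbhs_config (Sigma : finType) (x : config Sigma) (W : seq Z2) :
  nbhs x [set y : config Sigma | forall z, z \in W -> y z = x z].
Proof.
elim: W => [|u W IH]; first by apply: filterS filterT.
have Hu : nbhs x [set y : config Sigma | y u = x u].
  exact: (@proj_continuous _ (fun=> discrete_topology Sigma) u x _
    (discrete_set1 _)).
apply: filterS (filterI Hu IH) => y [yu yW] z.
by rewrite inE => /orP[/eqP ->|/yW].
Qed.

Lemma ball_seq (r : nat) :
  exists W : seq Z2, forall z, (norm_oo z <= r)%N -> z \in W.
Proof.
pose L : seq int := [seq i%:Z - r%:Z | i <- iota 0 (2 * r).+1].
exists [seq (a, b) | a <- L, b <- L] => -[a b] ab.
have inL (c : int) : (`|c| <= r)%N -> c \in L.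
  move=> cr; apply/mapP; exists `|(c + r%:Z)%R|%N; last by lia.
  by rewrite mem_iota; lia.
by apply/allpairsP; exists (a, b); split => //; apply: inL;
  move: ab; rewrite /norm_oo /=; lia.
Qed.

(** A cluster point of the sequence works: an avoidance of [q i] near the origin is seen on finitely
    many cells, where the cluster point agrees with some [u n] having [i < n]. *)
Lemma good_limit (Sigma : finType) (X : set (config Sigma)) (q : nat -> Z2) :
  closed X -> (forall k, exists2 x, X x & good x q k 0) ->
  exists2 x, X x & forall k, good x q k 0.
Proof.
move=> cX hX; have /choice[u hu] k : exists x, X x /\ good x q k 0.
  by have [x ? ?] := hX k; exists x.
have [] := @compact_config Sigma (u @ \oo) _ filterT.
move=> x [_ cx]; exists x.
  apply: cX => B nB; have [//|y [Xy By]] := cx X B _ nB.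
    by exists 0%N => // n _; have [] := hu n.
  by exists y.
move=> k i ik.
have [W hW] := ball_seq (radius i.+1 + norm_oo (q i)).
have [|y [[n kn yE] yW]] := cx [set y | exists2 n, (k <= n)%N & y = u n] _ _
  (nbhs_config x W).
  by exists k => // n /= kn; exists n.
have [z z0 xz] := (hu n).2 i (leq_trans ik kn); exists z => //.
have d0 (v : Z2) : dist v 0 = norm_oo v by rewrite /dist subr0.
rewrite -!yW ?yE //; apply: hW.
  have := dist_addl z (q i) 0; rewrite !d0 in z0 *; lia.
by rewrite -d0; apply: leq_trans z0 (leq_addr _ _).
Qed.

Lemma good_shift (Sigma : finType) (x : config Sigma) (q : nat -> Z2) k z :
  good x q k z -> good (shift z x) q k 0.
Proof.
move=> gz i ik; have [y yz xy] := gz i ik.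
by exists (y - z); rewrite /shift ?addrNK // ?[y - z + _]addrAC ?addrNK // /dist subr0.
Qed.

Theorem theorem1 :
  exists f : nat -> nat, computable f /\
    forall (Sigma : finType) (X : set (config Sigma)),
      subshift X ->
      (forall P : set Z2, finite_set P -> ~ P 0 ->
         exists x : config Sigma, X x /\ forall p : Z2, P p -> avoids x p) ->
      exists x : config Sigma,
        [/\ X x,
            aperiodic x
          & forall p : Z2, p <> 0 ->
              exists z : Z2,
                (norm_oo z <= f (norm_oo p))%N /\ avoids_at x p z].
Proof.
exists (fun n => radius (35 * 6 ^ n).+1); split.
  exact: computable_avoidance_bound.
move=> Sigma X [cX shX] avX.
have [k|x Xx gx] := @good_limit Sigma X vector_enum cX.
  (* Avoiding these multiples is what [good_spot] requires for a k-good point. *)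
  pose P : set Z2 := [set vector_enum i *~ mult i | i in `I_k].
  have [||x [Xx avx]] := avX P.
  - exact/finite_image/finite_II.
  - move=> [i _ /(congr1 norm_oo)]; rewrite norm_oo_mulz => /eqP.
    rewrite muln_eq0 => /orP[|] /eqP; first by have := mult_gt0 i; lia.
    by have := norm_oo_gt0 (@vector_enum_neq0 i); lia.
  - have [|z gz] := good_spot (k := k) (x := x) vector_enum_neq0 norm_vector_enum.
      by move=> i ik; apply: avx; exists i.
    by exists (shift z x); [exact: shX|exact: good_shift].
have avp p : p <> 0 -> exists z : Z2,
    (norm_oo z <= radius (35 * 6 ^ norm_oo p).+1)%N /\ avoids_at x p z.
  (* At the origin, [p = vector_enum k] is avoided within [radius k.+1], and [radius] is
     monotone. *)
  move=> /vector_enum_surj[k + pE]; rewrite -{p}pE => kp.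
  have [z z0 xz] := gx k.+1 k (ltnSn k); exists z; split => //.
  rewrite /dist subr0 in z0; apply: leq_trans z0 _.
  exact: (@leq_radius k.+1).
exists x; split=> // -[v [v0 xv]].
by have [z [_ []]] := avp v v0; exact: xv.
Qed.
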